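(* For each $i\in\mathbb{N}$ let $\rho_i$ and $\sigma_i$ be quantum states on a finite dimensional Hilbert space $\mathcal{H}_i$ that satisfy $\sigma_i\ll\rho_i$, and let $$\rho^{(n)}:=\bigotimes_{i=1}^n\rho_i,\qquad\sigma^{(n)}:=\bigotimes_{i=1}^n\sigma_i .$$ Then $\sigma^{(n)}\vartriangleleft\rho^{(n)}$ if and only if $$\prod_{i=1}^\infty\mathrm{Tr}\,\rho_iR_i>0,$$ or equivalently $$\sum_{i=1}^\infty(1-\mathrm{Tr}\,\rho_iR_i)<\infty,$$ where $R_i$ is (a version of) the square-root likelihood ratio $\mathcal{R}(\sigma_i\mid\rho_i)$.
   Context: Quantum states are density operators; observables on finite dimensional spaces are Hermitian operators; ''positive'' means positive semidefinite. For positive operators on a finite dimensional Hilbert space $\mathcal{H}$: $\mathrm{supp}\,\rho:=(\ker\rho)^\perp$; $\sigma\!\downharpoonleft_{\mathrm{supp}\,\rho}:=\iota_\rho^*\sigma\iota_\rho$ with $\iota_\rho:\mathrm{supp}\,\rho\hookrightarrow\mathcal{H}$ the inclusion; $\rho\perp\sigma$ (singular) means $\sigma\!\downharpoonleft_{\mathrm{supp}\,\rho}=0$ (a symmetric relation); $\rho\ll\sigma$ (absolutely continuous) means $\sigma\!\downharpoonleft_{\mathrm{supp}\,\rho}>0$. A version of the square-root likelihood ratio $\mathcal{R}(\sigma\mid\rho)$ is any positive operator $R$ such that $\sigma=R\rho R+\tau$ with $\tau\ge0$, $\tau\perp\rho$ (such $R$ exists). Contiguity: let $\mathbf{1}_M(x)=1$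 if $|x|\le M$ and $0$ otherwise. A sequence $O^{(n)}$ of observables is $L^2$-infinitesimal under $\rho^{(n)}$ if $\lim_n\mathrm{Tr}\,\rho^{(n)}O^{(n)2}=0$. For positive operators $A^{(n)}$, $A^{(n)2}$ is uniformly integrable under $\rho^{(n)}$ if for every $\varepsilon>0$ there is $M>0$ with $\sup_n\mathrm{Tr}\,\rho^{(n)}A^{(n)2}(I-\mathbf{1}_M(A^{(n)}))<\varepsilon$. $\sigma^{(n)}\vartriangleleft\rho^{(n)}$ means: with $R^{(n)}$ a version of $\mathcal{R}(\sigma^{(n)}\mid\rho^{(n)})$, (i) $\lim_n\mathrm{Tr}\,\rho^{(n)}R^{(n)2}=1$, and (ii) there is an $L^2$-infinitesimal sequence $O^{(n)}$ of observables such that $R^{(n)}+O^{(n)}$ is positive and $(R^{(n)}+O^{(n)})^2$ is uniformly integrable under $\rho^{(n)}$ (independent of the version). Here $\prod_{i=1}^\infty$ denotes the limit of the partial products. *)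

(* Defs.v *)
From mathcomp Require Import all_boot all_order all_algebra.
From mathcomp Require Import all_classical all_reals all_analysis.
From mathcomp Require Import complex.
(* Not imported: its notation "A ^t k" clashes with "M ^t phi" of
   sesquilinear. *)
From mathcomp Require mxtens.

Set Implicit Arguments.
Unset Strict Implicit.
Unset Printing Implicit Defensive.

Import Order.TTheory GRing.Theory Num.Theory.
Import numFieldNormedType.Exports.

Local Open Scope classical_set_scope.
Local Open Scope sesquilinear_scope.
Local Open Scope ring_scope.

(* An n-dimensional Hilbert space is C^n with its standard inner product;
   operators are matrices acting on column vectors, x |-> A *m x. *)

Section Operators.
Variable R : realType.
Local Notation C := R[i].

Definition psd n (A : 'M[C]_n) : Prop :=
  A \is hermsymmx /\ forall x : 'cV[C]_n, 0 <= (x ^t* *m A *m x) 0 0.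

Definition posdef n (A : 'M[C]_n) : Prop :=
  A \is hermsymmx /\
  forall x : 'cV[C]_n, x != 0 -> 0 < (x ^t* *m A *m x) 0 0.

Definition state n (A : 'M[C]_n) : Prop := psd A /\ \tr A = 1.

(* Only used for traces that are real (products of two Hermitian matrices). *)
Definition retr n (A : 'M[C]_n) : R := complex.Re (\tr A).

(* The rows of [kermx rho^T] span the transposes of the x with rho *m x = 0,
   so the row space of [supp rho] consists of the transposes of the vectors
   of (ker rho)^\bot. *)
Definition supp n (rho : 'M[C]_n) : 'M[C]_n :=
  orthomx Num.conj (mx_of_hermitian (hermitian1mx n)) (kermx rho^T).

(* The inclusion of (ker rho)^\bot, written in an orthonormal basis of
   (ker rho)^\bot, whose vectors are the columns of [supp_incl rho]. *)
Definition supp_incl n (rho : 'M[C]_n) : 'M[C]_(n, \rank (supp rho)) :=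
  (schmidt (row_base (supp rho)))^T.

Definition restr n (sigma rho : 'M[C]_n) : 'M[C]_(\rank (supp rho)) :=
  (supp_incl rho) ^t* *m sigma *m supp_incl rho.

Definition singular n (rho sigma : 'M[C]_n) : Prop := restr sigma rho = 0.

(* rho << sigma *)
Definition abs_cont n (rho sigma : 'M[C]_n) : Prop :=
  posdef (restr sigma rho).

Definition sqrt_lr_version n (sigma rho L : 'M[C]_n) : Prop :=
  psd L /\
  exists tau : 'M[C]_n,
    [/\ psd tau, singular tau rho & sigma = L *m rho *m L + tau].

(* Functional calculus; meaningful when A is normal. *)
Definition fun_calc n (f : C -> C) (A : 'M[C]_n) : 'M[C]_n :=
  invmx (spectralmx A) *m diag_mx (map_mx f (spectral_diag A))
    *m spectralmx A.

Definition trunc n (M : R) (A : 'M[C]_n) : 'M[C]_n :=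
  fun_calc (fun x => if `|x| <= M%:C%C then 1 else 0) A.

Section Sequences.
Variable D : nat -> nat.

Definition L2_infinitesimal (rho O : forall n, 'M[C]_(D n)) : Prop :=
  (fun n => retr (rho n *m (O n *m O n))) @ \oo --> (0 : R).

(* Uniform integrability of A^2 under rho. *)
Definition sq_unif_integrable (rho A : forall n, 'M[C]_(D n)) : Prop :=
  forall eps : R, 0 < eps -> exists2 M : R, 0 < M &
    (ereal_sup (range (fun n =>
       (retr (rho n *m (A n *m A n) *m (1%:M - trunc M (A n))))%:E))
     < eps%:E)%E.

(* sigma is contiguous to rho. *)
Definition contiguous (sigma rho : forall n, 'M[C]_(D n)) : Prop :=
  exists L : forall n, 'M[C]_(D n),
    [/\ forall n, sqrt_lr_version (sigma n) (rho n) (L n),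
        (fun n => retr (rho n *m (L n *m L n))) @ \oo --> (1 : R)
      & exists O : forall n, 'M[C]_(D n),
          [/\ forall n, O n \is hermsymmx,
              L2_infinitesimal rho O,
              forall n, psd (L n + O n)
            & sq_unif_integrable rho (fun n => L n + O n)]].

End Sequences.

Fixpoint tens_dim (d : nat -> nat) (n : nat) : nat :=
  if n is m.+1 then (tens_dim d m * d m)%N else 1%N.

(* A_0 (x) ... (x) A_(n-1); the empty product is the 1 x 1 identity. *)
Fixpoint tens (d : nat -> nat) (A : forall i, 'M[C]_(d i)) (n : nat) :
    'M[C]_(tens_dim d n) :=
  if n is m.+1 then mxtens.tensmx (tens A m) (A m) else 1%:M.

End Operators.

(* Main.v *)
Require Import Defs.
From mathcomp Require Import all_boot all_order all_algebra.
From mathcomp Require Import all_classical all_reals all_analysis.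
From mathcomp Require Import complex ring lra.
From mathcomp Require mxtens.
Import Order.TTheory GRing.Theory Num.Theory.
Import numFieldNormedType.Exports.
Local Open Scope classical_set_scope.
Local Open Scope ring_scope.

(** This is a noncommutative Kakutani theorem.  Write a_i = Tr rho_i L_i and
    p_n = a_0 ... a_(n-1).  Absolute continuity kills the singular part
    (abs_cont_singular_part), so sigma_i = L_i rho_i L_i and
    Tr rho_i L_i^2 = Tr sigma_i = 1; expanding Tr rho_i (1 - L_i)^2 >= 0 gives
    a_i <= 1, while a_i = 0 would force sigma_i = 0.  Hence 0 < a_i <= 1, and
    the equivalence between the product and the sum is an elementary fact about
    such sequences (prod_pos_iff_summable).

    Everything multiplies over tensor factors: X_n = L_0 (x) ... (x) L_(n-1) is
    a version of the likelihood ratio of the n-fold products, with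
    Tr rho X_n^2 = 1 and Tr rho X_n = p_n.

    If p_n tends to l > 0, then X_n^2 itself is uniformly integrable, and no
    infinitesimal correction is required.  Compare X = X_n with the operator Y
    that keeps only the first m factors of X and replaces the others by 1.
    The L^2-distance is Tr rho (X - Y)^2 = 2 (1 - a_m ... a_(n-1)), small
    uniformly in n once p_m is close to l.  If P is the spectral projection of
    X on (M, oo), then P <= X / M, and so the part of the tail that comes from Y
    is at most Tr rho Y X Y / M, where Tr rho Y X Y is bounded in n because the
    factors of index i >= m contribute a_i <= 1.  This is retr_tail_le; the
    operator inequality P <= X / M replaces the pointwise comparison of X and Y
    on the event X > M, which has no meaning for noncommuting X and Y.

    Conversely, let X be any version and A = X + O positive with A^2 uniformly
    integrable.  On the spectral subspace where A <= M one has A^2 <= M A, so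
    that Tr rho A^2 is at most a small tail plus M Tr rho A, and Tr rho A is
    close to Tr rho X (retr_sqr_le).  All versions share the value
    Tr rho X = p_n, because with rho = K K^t* the operator K^t* X K is the
    unique positive square root of K^t* sigma K (version_retr_unique).  If p_n
    tended to 0, Tr rho X^2 would be asymptotically at most 3/8, contradicting
    its limit 1.  Since p_n is nonincreasing, its limit is then positive. *)

Set Implicit Arguments.
Unset Strict Implicit.
Unset Printing Implicit Defensive.

(** * Positive operators as Gram matrices *)

Section PositiveOperators.
Local Open Scope sesquilinear_scope.
Variable R : realType.
Local Notation C := R[i].

Lemma adjmxM m n p (A : 'M[C]_(m, n)) (B : 'M[C]_(n, p)) :
  (A *m B) ^t* = B ^t* *m A ^t*.
Proof. by rewrite trmx_mul map_mxM. Qed.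

Lemma adjmxB m n (A B : 'M[C]_(m, n)) : (A - B) ^t* = A ^t* - B ^t*.
Proof. by rewrite linearB /= map_mxB. Qed.

Lemma adjmx1 n : (1%:M : 'M[C]_n) ^t* = 1%:M.
Proof. by rewrite trmx1 map_mx1. Qed.

Lemma hermE n (A : 'M[C]_n) : (A \is hermsymmx) = (A ^t* == A).
Proof. by rewrite qualifE /= expr0 scale1r eq_sym. Qed.

Lemma psd_adj n (A : 'M[C]_n) : psd A -> A ^t* = A.
Proof. by case; rewrite hermE => /eqP. Qed.

Lemma mxtrace_gram m n (K : 'M[C]_(m, n)) :
  \tr (K *m K ^t*) = \sum_i \sum_j `|K i j| ^+ 2.
Proof.
apply: eq_bigr => i _; rewrite mxE; apply: eq_bigr => j _.
by rewrite !mxE normCK.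
Qed.

Lemma mxtrace_gram_ge0 m n (K : 'M[C]_(m, n)) : 0 <= \tr (K *m K ^t*).
Proof.
by rewrite mxtrace_gram; do 2 (apply: sumr_ge0 => ? _); rewrite exprn_ge0.
Qed.

Lemma mxtrace_gram_eq0 m n (K : 'M[C]_(m, n)) : \tr (K *m K ^t*) = 0 -> K = 0.
Proof.
rewrite mxtrace_gram => /eqP; rewrite psumr_eq0; last first.
  by move=> ? _; apply: sumr_ge0 => ? _; rewrite exprn_ge0.
move=> /allP h; apply/matrixP => i j; rewrite mxE.
have := h i (mem_index_enum _); rewrite psumr_eq0; last first.
  by move=> ? _; rewrite exprn_ge0.
move=> /allP /(_ j (mem_index_enum _)) /=.
by rewrite expf_eq0 /= normr_eq0 => /eqP.
Qed.

Lemma gram_psd m n (K : 'M[C]_(m, n)) : psd (K *m K ^t*).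
Proof.
split; first by rewrite hermE adjmxM trmxCK.
move=> x; have -> : x ^t* *m (K *m K ^t*) *m x
                    = (x ^t* *m K) *m (x ^t* *m K) ^t*.
  by rewrite adjmxM trmxCK !mulmxA.
by have := mxtrace_gram_ge0 (x ^t* *m K); rewrite /mxtrace big_ord1.
Qed.

Lemma spectral_diagE n (A : 'M[C]_n) i : A \is hermsymmx ->
  spectral_diag A 0 i = ((col i ((spectralmx A) ^t*)) ^t* *m A
                         *m col i ((spectralmx A) ^t*)) 0 0.
Proof.
move=> /hermitian_normalmx /orthomx_spectralP.
rewrite invmx_unitary ?spectral_unitarymx //.
have /unitarymxP := spectral_unitarymx A.
move: (spectralmx A) (spectral_diag A) => U v UU ->.
rewrite colE adjmxM trmxCK !mulmxA.
rewrite -[_ *m U *m U ^t*]mulmxA UU mulmx1.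
rewrite -[_ *m U *m U ^t*]mulmxA UU mulmx1.
rewrite trmx_delta map_delta_mx -rowE -colE.
by rewrite !mxE eqxx mulr1n.
Qed.

Lemma spectral_diag_ge0 n (A : 'M[C]_n) i : psd A -> 0 <= spectral_diag A 0 i.
Proof. by case=> hA posA; rewrite spectral_diagE. Qed.

(** All functions of A are of this form, with a row v of eigenvalues in the
    eigenbasis of A, so that their calculus reduces to pointwise identities and
    inequalities between rows. *)
Definition spectral_op n (A : 'M[C]_n) (v : 'rV[C]_n) : 'M[C]_n :=
  (spectralmx A) ^t* *m diag_mx v *m spectralmx A.

Lemma herm_spectral_op n (A : 'M[C]_n) : A \is hermsymmx ->
  A = spectral_op A (spectral_diag A).
Proof.
move=> /hermitian_normalmx /orthomx_spectralP {1}->.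
by rewrite invmx_unitary ?spectral_unitarymx.
Qed.

Lemma fun_calc_spectral_op n (f : C -> C) (A : 'M[C]_n) :
  fun_calc f A = spectral_op A (map_mx f (spectral_diag A)).
Proof. by rewrite /fun_calc invmx_unitary ?spectral_unitarymx. Qed.

Lemma spectral_opM n (A : 'M[C]_n) u v :
  spectral_op A u *m spectral_op A v = spectral_op A (\row_i (u 0 i * v 0 i)).
Proof.
have UU : spectralmx A *m (spectralmx A) ^t* = 1%:M.
  exact/unitarymxP/spectral_unitarymx.
rewrite /spectral_op !mulmxA -[_ *m spectralmx A *m _]mulmxA UU mulmx1.
by rewrite -[_ *m diag_mx u *m _]mulmxA mulmx_diag.
Qed.

Lemma spectral_op1 n (A : 'M[C]_n) : spectral_op A (const_mx 1) = 1%:M.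
Proof.
rewrite /spectral_op diag_const_mx mulmx1 -invmx_unitary ?spectral_unitarymx //.
by rewrite mulVmx ?spectral_unit.
Qed.

Lemma spectral_opB n (A : 'M[C]_n) u v :
  spectral_op A u - spectral_op A v = spectral_op A (u - v).
Proof. by rewrite /spectral_op -mulmxBl -mulmxBr -[diag_mx u - _]raddfB. Qed.

Lemma spectral_opZ n (A : 'M[C]_n) c u :
  c *: spectral_op A u = spectral_op A (c *: u).
Proof.
by rewrite /spectral_op [diag_mx (c *: u)]linearZ /= -scalemxAr -scalemxAl.
Qed.

Lemma spectral_op_gram n (A : 'M[C]_n) (v : 'rV[C]_n) :
  (forall i, 0 <= v 0 i) ->
  exists K : 'M[C]_n, spectral_op A v = K *m K ^t*.
Proof.
move=> v0; exists ((spectralmx A) ^t* *m diag_mx (map_mx sqrtC v)).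
rewrite adjmxM trmxCK mulmxA; congr (_ *m _).
rewrite -mulmxA; congr (_ *m _).
rewrite tr_diag_mx map_diag_mx mulmx_diag; congr diag_mx.
apply/rowP => i; rewrite !mxE.
by rewrite /= geC0_conj ?sqrtC_ge0 // -expr2 sqrtCK.
Qed.

Lemma psd_spectral_op n (A : 'M[C]_n) (v : 'rV[C]_n) :
  (forall i, 0 <= v 0 i) -> psd (spectral_op A v).
Proof. by move=> /(spectral_op_gram A)[K ->]; exact: gram_psd. Qed.

(** The factorization through which positivity is used below: traces of products
    and quadratic forms of A become sums of squared moduli. *)
Lemma psd_gram n (A : 'M[C]_n) : psd A -> exists K : 'M[C]_n, A = K *m K ^t*.
Proof.
move=> Apsd; have [Ah _] := Apsd; rewrite (herm_spectral_op Ah).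
by apply: spectral_op_gram => i; exact: spectral_diag_ge0.
Qed.

Lemma psd0 n : psd (0 : 'M[C]_n).
Proof. by have := gram_psd (0 : 'M[C]_n); rewrite mul0mx. Qed.

Lemma psd1 n : psd (1%:M : 'M[C]_n).
Proof. by have := gram_psd (1%:M : 'M[C]_n); rewrite adjmx1 mulmx1. Qed.

Lemma psd_congr m n (A : 'M[C]_n) (X : 'M[C]_(n, m)) :
  psd A -> psd (X ^t* *m A *m X).
Proof.
move=> /psd_gram[K ->]; have := gram_psd (X ^t* *m K).
by rewrite adjmxM trmxCK !mulmxA.
Qed.

Lemma psd_mxtrace_ge0 n (A : 'M[C]_n) : psd A -> 0 <= \tr A.
Proof. by move=> /psd_gram[K ->]; exact: mxtrace_gram_ge0. Qed.

Lemma psd_mxtrace_eq0 n (A : 'M[C]_n) : psd A -> \tr A = 0 -> A = 0.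
Proof. by move=> /psd_gram[K ->] /mxtrace_gram_eq0 ->; rewrite mul0mx. Qed.

Lemma psd_addr_eq0 n (A B : 'M[C]_n) : psd A -> psd B -> A + B = 0 -> A = 0.
Proof.
move=> hA hB /(congr1 mxtrace); rewrite mxtraceD mxtrace0 => /eqP.
rewrite paddr_eq0 ?psd_mxtrace_ge0 // => /andP[/eqP trA _].
exact: psd_mxtrace_eq0.
Qed.

(** With A = K K^t* the hypothesis says X^t* K = 0. *)
Lemma psd_congr_eq0 m n (A : 'M[C]_n) (X : 'M[C]_(n, m)) :
  psd A -> X ^t* *m A *m X = 0 -> A *m X = 0.
Proof.
move=> /psd_gram[K ->]; rewrite !mulmxA => XKKX.
have XK0 : X ^t* *m K = 0.
  by apply: mxtrace_gram_eq0; rewrite adjmxM trmxCK !mulmxA XKKX mxtrace0.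
by rewrite -mulmxA -[K ^t* *m X]trmxCK adjmxM trmxCK XK0 trmx0 map_mx0 mulmx0.
Qed.

(** This is what makes the fidelity Tr rho L independent of the version L. *)
Lemma psd_sqr_inj n (A B : 'M[C]_n) :
  psd A -> psd B -> A *m A = B *m B -> A = B.
Proof.
move=> hA hB AB; have [D DE] : exists D, D = A - B by exists (A - B).
have Dh : D ^t* = D by rewrite DE adjmxB !psd_adj.
have DAD : psd (D *m A *m D) by rewrite -{1}Dh; exact: psd_congr.
have DBD : psd (D *m B *m D) by rewrite -{1}Dh; exact: psd_congr.
(* D vanishes: the trace of D (A D + D B) = 0 is Tr D A D + Tr D B D, two
   nonnegative terms that must vanish separately, so D A D = D B D = 0 *)
have ADDB : A *m D + D *m B = 0.
  by rewrite DE mulmxBl mulmxBr AB addrA subrK subrr.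
have trS : \tr (D *m A *m D) + \tr (D *m B *m D) = 0.
  rewrite [\tr (D *m B *m D)]mxtrace_mulC -mxtraceD -mulmxA -mulmxDr ADDB.
  by rewrite mulmx0 mxtrace0.
move/eqP: trS; rewrite paddr_eq0 ?psd_mxtrace_ge0 // => /andP[/eqP tA /eqP tB].
have D3 : D *m D *m D = 0.
  rewrite [in X in _ *m X *m _]DE mulmxBr mulmxBl (psd_mxtrace_eq0 DAD tA).
  by rewrite (psd_mxtrace_eq0 DBD tB) subrr.
have D2 : D *m D = 0.
  by apply: mxtrace_gram_eq0; rewrite adjmxM Dh mulmxA D3 mul0mx mxtrace0.
apply/eqP; rewrite -subr_eq0; apply/eqP/mxtrace_gram_eq0.
by rewrite -DE Dh D2 mxtrace0.
Qed.

Lemma psd_sqr n (A : 'M[C]_n) : A \is hermsymmx -> psd (A *m A).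
Proof. by rewrite hermE => /eqP Ah; rewrite -{2}Ah; exact: gram_psd. Qed.

Lemma psd_sandwich n (G A : 'M[C]_n) :
  G \is hermsymmx -> psd A -> psd (G *m A *m G).
Proof. by rewrite hermE => /eqP Gh hA; rewrite -{1}Gh; exact: psd_congr. Qed.

Lemma hermB n (A B : 'M[C]_n) :
  A \is hermsymmx -> B \is hermsymmx -> A - B \is hermsymmx.
Proof. by rewrite !hermE adjmxB => /eqP -> /eqP ->. Qed.

End PositiveOperators.

(** * Real traces *)

Section Traces.
Local Open Scope sesquilinear_scope.
Variable R : realType.
Local Notation C := R[i].

Lemma retrD n (A B : 'M[C]_n) : retr (A + B) = retr A + retr B.
Proof. by rewrite /retr mxtraceD raddfD. Qed.

Lemma retrB n (A B : 'M[C]_n) : retr (A - B) = retr A - retr B.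
Proof. by rewrite /retr !raddfB. Qed.

Lemma retrZ n (c : R) (A : 'M[C]_n) : retr (c%:C%C *: A) = c * retr A.
Proof.
by rewrite /retr mxtraceZ; case: (\tr A) => x y /=; rewrite mul0r subr0.
Qed.

Lemma retr_mulC m n (A : 'M[C]_(m, n)) (B : 'M[C]_(n, m)) :
  retr (A *m B) = retr (B *m A).
Proof. by rewrite /retr mxtrace_mulC. Qed.

Lemma mxtrace_psdM_ge0 n (A B : 'M[C]_n) : psd A -> psd B -> 0 <= \tr (A *m B).
Proof.
move=> /psd_gram[K ->] hB; rewrite -mulmxA mxtrace_mulC.
exact/psd_mxtrace_ge0/psd_congr.
Qed.

Lemma ge0_ReE (z : C) : 0 <= z -> z = (complex.Re z)%:C%C.
Proof. by case: z => x y; rewrite lecE /= => /andP[/eqP-> _]. Qed.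

Lemma mxtrace_psdM n (A B : 'M[C]_n) : psd A -> psd B ->
  \tr (A *m B) = (retr (A *m B))%:C%C.
Proof. by move=> hA hB; apply: ge0_ReE; exact: mxtrace_psdM_ge0. Qed.

Lemma retr_psdM_ge0 n (A B : 'M[C]_n) : psd A -> psd B -> 0 <= retr (A *m B).
Proof.
move=> hA hB; have := mxtrace_psdM_ge0 hA hB; rewrite (mxtrace_psdM hA hB).
by rewrite lecR.
Qed.

Lemma retr_psdM_le n (A B B' : 'M[C]_n) : psd A -> psd (B' - B) ->
  retr (A *m B) <= retr (A *m B').
Proof. by move=> hA hB; rewrite -subr_ge0 -retrB -mulmxBr retr_psdM_ge0. Qed.

(** The convexity inequality (g + h)^2 <= 2 g^2 + 2 h^2 in a form that needs no
    commutation: the difference of the two sides is the trace of rho against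
    the positive operator (G - H) P (G - H). *)
Lemma retr_parallelogram n (rho P G H : 'M[C]_n) : psd rho -> psd P ->
  G \is hermsymmx -> H \is hermsymmx ->
  retr (rho *m ((G + H) *m P *m (G + H)))
    <= 2 * retr (rho *m (G *m P *m G)) + 2 * retr (rho *m (H *m P *m H)).
Proof.
move=> hrho hP Gh Hh.
have := retr_psdM_ge0 hrho (psd_sandwich (hermB Gh Hh) hP).
pose q X Y := retr (rho *m (X *m P *m Y)).
have qDl X X' Y : q (X + X') Y = q X Y + q X' Y.
  by rewrite /q mulmxDl mulmxDl mulmxDr retrD.
have qDr X Y Y' : q X (Y + Y') = q X Y + q X Y'.
  by rewrite /q mulmxDr mulmxDr retrD.
have qBl X X' Y : q (X - X') Y = q X Y - q X' Y.
  by rewrite /q mulmxBl mulmxBl mulmxBr retrB.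
have qBr X Y Y' : q X (Y - Y') = q X Y - q X Y'.
  by rewrite /q mulmxBr mulmxBr retrB.
rewrite -/(q (G + H) (G + H)) -/(q (G - H) (G - H)) -/(q G G) -/(q H H).
rewrite qBl !qBr qDl !qDr.
move: (q G G) (q G H) (q H G) (q H H) => gg gh hg hh; lra.
Qed.

Lemma retr_sqrB n (rho A B : 'M[C]_n) :
  retr (rho *m ((A - B) *m (A - B))) =
    retr (rho *m (A *m A)) - retr (rho *m (A *m B))
    - (retr (rho *m (B *m A)) - retr (rho *m (B *m B))).
Proof.
have -> : (A - B) *m (A - B) = A *m A - A *m B - (B *m A - B *m B).
  by rewrite mulmxBl !mulmxBr.
by rewrite mulmxBr mulmxBr [rho *m (B *m A - _)]mulmxBr 3!retrB.
Qed.

End Traces.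

(** * Spectral truncation *)

Section Truncation.
Local Open Scope sesquilinear_scope.
Variable R : realType.
Local Notation C := R[i].

Lemma spectral_truncP n (M : R) (A B : 'M[C]_n) (v : 'rV[C]_n)
    (T := spectral_op A (map_mx (fun x => if `|x| <= M%:C%C then 1 else 0) v)) :
  0 < M -> (forall i, 0 <= v 0 i) -> B = spectral_op A v ->
  [/\ psd T, psd (1%:M - T), psd (B - M%:C%C *: (1%:M - T)),
      psd (M%:C%C *: B - B *m B *m T)
    & B *m B *m (1%:M - T) = B *m (1%:M - T) *m B].
Proof.
move=> M0 v0 ->; have M0C : 0 <= M%:C%C :> C by rewrite lecR ltW.
rewrite /T -(spectral_op1 A) !spectral_opB !spectral_opZ !spectral_opM.
rewrite !spectral_opB.
have nv i : `|v 0 i| = v 0 i by rewrite ger0_norm.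
have cmp i : (v 0 i <= M%:C%C) = false -> M%:C%C <= v 0 i.
  by move=> /negbT; rewrite -real_ltNge ?ger0_real // => /ltW.
split.
- by apply: psd_spectral_op => i; rewrite !mxE nv; case: ifP.
- apply: psd_spectral_op => i; rewrite !mxE nv.
  by case: ifP; rewrite ?subrr ?subr0.
- apply: psd_spectral_op => i; rewrite !mxE nv; case: ifP => [_|/cmp].
    by rewrite subrr mulr0 subr0.
  by rewrite subr0 mulr1 subr_ge0.
- apply: psd_spectral_op => i; rewrite !mxE nv; case: ifP => [vM|_].
    by rewrite mulr1 -mulrBl mulr_ge0 // subr_ge0.
  by rewrite mulr0 subr0 mulr_ge0.
- by congr spectral_op; apply/rowP => i; rewrite !mxE mulrAC.
Qed.

(** With T the projection on the eigenvalues at most M, the third and fourth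
    items are the Markov-type bounds 1_(a > M) <= a / M and
    a^2 1_(a <= M) <= M a, one for each direction of the theorem. *)
Lemma truncP n (M : R) (A : 'M[C]_n) : 0 < M -> psd A ->
  [/\ psd (trunc M A), psd (1%:M - trunc M A),
      psd (A - M%:C%C *: (1%:M - trunc M A)),
      psd (M%:C%C *: A - A *m A *m trunc M A)
    & A *m A *m (1%:M - trunc M A) = A *m (1%:M - trunc M A) *m A].
Proof.
move=> M0 hA; rewrite /trunc fun_calc_spectral_op.
exact: (spectral_truncP M0 (fun i => spectral_diag_ge0 i hA)
                        (herm_spectral_op hA.1)).
Qed.

End Truncation.

(** * Supports and versions of the square-root likelihood ratio *)

Section Supports.
Local Open Scope sesquilinear_scope.
Variable R : realType.
Local Notation C := R[i].

(** The columns of B lie in the orthogonal complement of ker A as soon as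
    B^t* vanishes on ker A; the statement then writes them in the orthonormal
    basis of that complement. *)
Lemma supp_incl_factor n m (A : 'M[C]_n) (B : 'M[C]_(n, m)) :
  (forall p (X : 'M[C]_(n, p)), A *m X = 0 -> B ^t* *m X = 0) ->
  exists Z, B = supp_incl A *m Z.
Proof.
move=> kerAB.
have : (B^T <= schmidt (row_base (supp A)))%MS.
  rewrite eqmx_schmidt_free ?row_base_free // eq_row_base.
  apply/orthomx1P; have := kerAB _ (kermx A^T)^T.
  rewrite -[A in A *m _]trmxK -trmx_mul mulmx_ker trmx0 => /(_ erefl).
  move=> /(congr1 (map_mx Num.conj)); rewrite map_mxM map_mx0 /=.
  by rewrite -map_mx_comp (map_mx_id (@conjCK _)).
case/submxP => Z BZ; exists Z^T.
by rewrite -[B]trmxK BZ trmx_mul.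
Qed.

Lemma supp_incl_self n (A : 'M[C]_n) : A \is hermsymmx ->
  exists Z, A = supp_incl A *m Z.
Proof.
by rewrite hermE => /eqP Ah; apply: supp_incl_factor => p X; rewrite Ah.
Qed.

(** Since A factors through its support, A^t* B A is a compression of the zero
    operator, and positivity of B upgrades A^t* B A = 0 to B A = 0. *)
Lemma singular_mul0 n (A B : 'M[C]_n) :
  psd A -> psd B -> singular A B -> B *m A = 0.
Proof.
move=> hA hB AB; apply: psd_congr_eq0 => //.
have [Z AZ] := supp_incl_self hA.1.
have -> : A ^t* *m B *m A = Z ^t* *m restr B A *m Z.
  by rewrite {1 2}AZ adjmxM /restr !mulmxA.
by rewrite AB mulmx0 mul0mx.
Qed.

Lemma posdef_congr_eq0 n m (A : 'M[C]_n) (X : 'M[C]_(n, m)) :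
  posdef A -> X ^t* *m A *m X = 0 -> X = 0.
Proof.
move=> [_ Apos] XAX; apply/matrixP => i j; rewrite mxE.
have [Xj0|/Apos] := eqVneq (col j X) 0.
  by move/matrixP/(_ i 0): Xj0; rewrite !mxE.
have -> : (col j X) ^t* *m A *m col j X
          = (delta_mx j 0) ^t* *m (X ^t* *m A *m X) *m delta_mx j 0.
  by rewrite colE adjmxM !mulmxA.
by rewrite XAX mulmx0 mul0mx mxE ltxx.
Qed.

(** Singularity gives rho tau = 0, and tau <= sigma puts the range of tau inside
    the support of sigma; there rho is positive definite, so tau = 0. *)
Lemma abs_cont_singular_part n (rho sigma K tau : 'M[C]_n) :
  psd rho -> psd sigma -> psd K -> psd tau -> abs_cont sigma rho ->
  singular tau rho -> sigma = K + tau -> tau = 0.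
Proof.
move=> hrho hsigma hK htau ac sing sE.
have rt := singular_mul0 htau hrho sing.
have [Z tZ] : exists Z, tau = supp_incl sigma *m Z.
  apply: supp_incl_factor => p X sX; rewrite psd_adj //.
  apply: psd_congr_eq0 => //.
  apply: (psd_addr_eq0 (psd_congr X htau) (psd_congr X hK)).
  by rewrite -mulmxDl -mulmxDr addrC -sE -mulmxA sX mulmx0.
suff Z0 : Z = 0 by rewrite tZ Z0 mulmx0.
apply: (posdef_congr_eq0 ac).
have -> : Z ^t* *m restr rho sigma *m Z = tau ^t* *m rho *m tau.
  by rewrite {1 2}tZ adjmxM /restr !mulmxA.
by rewrite -mulmxA rt mulmx0.
Qed.

Lemma version_eq n (rho sigma L : 'M[C]_n) :
  psd rho -> psd sigma -> abs_cont sigma rho -> sqrt_lr_version sigma rho L ->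
  sigma = L *m rho *m L.
Proof.
move=> hrho hsigma ac [hL [tau [htau sing sE]]].
have hK : psd (L *m rho *m L) by rewrite -{1}(psd_adj hL); exact: psd_congr.
by rewrite {1}sE (abs_cont_singular_part hrho hsigma hK htau ac sing sE) addr0.
Qed.

(** Let rho = K K^t*.  The singular part is invisible through K, so for every
    version X the positive operator K^t* X K squares to K^t* sigma K; its trace
    is Tr rho X. *)
Lemma version_retr_unique n (rho sigma L L' : 'M[C]_n) : psd rho ->
  sqrt_lr_version sigma rho L -> sqrt_lr_version sigma rho L' ->
  retr (rho *m L) = retr (rho *m L').
Proof.
move=> hrho; have [K rhoE] := psd_gram hrho.
have key X : sqrt_lr_version sigma rho X ->
    [/\ psd (K ^t* *m X *m K), retr (rho *m X) = retr (K ^t* *m X *m K)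
      & (K ^t* *m X *m K) *m (K ^t* *m X *m K) = K ^t* *m sigma *m K].
  move=> [hX [tau [htau sing ->]]].
  have tK : tau *m K = 0.
    apply: mxtrace_gram_eq0; rewrite adjmxM (psd_adj htau).
    have rt := singular_mul0 htau hrho sing.
    by rewrite mulmxA -[_ *m K *m _]mulmxA -rhoE -mulmxA rt mulmx0 mxtrace0.
  split; first exact: psd_congr.
    by rewrite rhoE -mulmxA retr_mulC.
  rewrite mulmxDr mulmxDl -[K ^t* *m tau *m K]mulmxA tK mulmx0 addr0.
  by rewrite rhoE !mulmxA.
move=> /key[hL -> sqL] /key[hL' -> sqL']; congr retr.
by apply: (psd_sqr_inj hL hL'); rewrite sqL sqL'.
Qed.

Lemma mxtrace_version_sqr n (rho sigma L : 'M[C]_n) : state rho ->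
  state sigma -> abs_cont sigma rho -> sqrt_lr_version sigma rho L ->
  \tr (rho *m (L *m L)) = 1.
Proof.
move=> [hrho _] [hsigma tr_sigma] ac hL.
by rewrite -tr_sigma (version_eq hrho hsigma ac hL) mulmxA mxtrace_mulC mulmxA.
Qed.

(** The upper bound expands Tr rho (1 - L)^2 >= 0.  For the lower one,
    Tr rho L = 0 would give L K = 0 where rho = K K^t*, hence
    sigma = L rho L = 0, although sigma has trace 1. *)
Lemma retr_version_bounds n (rho sigma L : 'M[C]_n) : state rho ->
  state sigma -> abs_cont sigma rho -> sqrt_lr_version sigma rho L ->
  0 < retr (rho *m L) <= 1.
Proof.
move=> hrho hsigma ac hL; have hLpsd := hL.1; apply/andP; split; last first.
  have := retr_psdM_ge0 hrho.1 (psd_sqr (hermB (psd1 R n).1 hLpsd.1)).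
  have -> : (1%:M - L) *m (1%:M - L) = 1%:M - L - (L - L *m L).
    by rewrite mulmxBl mul1mx mulmxBr mulmx1.
  rewrite !mulmxBr mulmx1 !retrB.
  have -> : retr rho = 1 by rewrite /retr hrho.2.
  have -> : retr (rho *m (L *m L)) = 1.
    by rewrite /retr (mxtrace_version_sqr hrho hsigma ac hL).
  by move: (retr _) => a; lra.
rewrite lt0r (retr_psdM_ge0 hrho.1 hLpsd) andbT.
apply/eqP => rL0; have tr0 : \tr (rho *m L) = 0.
  by rewrite (mxtrace_psdM hrho.1 hLpsd) rL0.
have [K rhoE] := psd_gram hrho.1.
have LK0 : L *m K = 0.
  apply: (psd_congr_eq0 hLpsd).
  apply: (psd_mxtrace_eq0 (psd_congr K hLpsd)).
  by rewrite -mulmxA mxtrace_mulC -mulmxA mxtrace_mulC -rhoE.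
have := hsigma.2; rewrite (version_eq hrho.1 hsigma.1 ac hL) rhoE mulmxA LK0.
by rewrite !mul0mx mxtrace0 => /eqP; rewrite eq_sym oner_eq0.
Qed.

(** The support of 0 is trivial, so the compression is an empty matrix. *)
Lemma singular0 n (A : 'M[C]_n) : singular 0 A.
Proof.
have r0 : \rank (supp (0 : 'M[C]_n)) = 0%N.
  by rewrite /supp rank_ortho mxrank_ker trmx0 mxrank0 subn0 subnn.
by apply/matrixP => i; have := ltn_ord i; rewrite {2}r0.
Qed.

End Supports.

(** * Two second-moment estimates *)

Lemma young_from_square (R : realFieldType) (s o q : R) : 0 < s ->
  0 <= s * s - s * o - (s * o - q) -> 2 * o <= s + s^-1 * q.
Proof.
move=> s0 h; rewrite -(ler_pM2l s0) [s * (s + _)]mulrDr mulVKf ?gt_eqF //.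
lra.
Qed.

Lemma collect_bounds (R : realFieldType) (M s x a q b k e c o : R) :
  x <= 2 * a + 2 * q -> a = b + k -> k <= M * e -> e = c + o ->
  M * (2 * o) <= M * (s + s^-1 * q) ->
  x <= 2 * b + 2 * M * c + M * s + (M / s + 2) * q.
Proof. by move=> h1 h2 h3 h4 h5; subst a e; lra. Qed.

Section Estimates.
Local Open Scope sesquilinear_scope.
Variable R : realType.
Local Notation C := R[i].

(** Let P be the spectral projection of X above M.  As P commutes with X, the
    left side is Tr rho X P X; splitting X = (X - Y) + Y on both sides of P,
    the first part uses P <= 1 and the second P <= X / M. *)
Lemma retr_tail_le n (rho X Y : 'M[C]_n) (M : R) : 0 < M ->
  psd rho -> psd X -> Y \is hermsymmx ->
  retr (rho *m (X *m X) *m (1%:M - trunc M X))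
    <= 2 * retr (rho *m ((X - Y) *m (X - Y)))
       + 2 / M * retr (rho *m (Y *m X *m Y)).
Proof.
move=> M0 hrho hX hY; have [hT hP PX _ PXX] := truncP M0 hX.
have [P PE] : exists P, P = 1%:M - trunc M X by exists (1%:M - trunc M X).
have TE : trunc M X = 1%:M - P by rewrite PE subKr.
rewrite -PE in hP PX PXX *.
have hD : X - Y \is hermsymmx by exact: hermB hX.1 hY.
rewrite -mulmxA PXX.
have -> : X *m P *m X = ((X - Y) + Y) *m P *m ((X - Y) + Y) by rewrite subrK.
apply: le_trans (retr_parallelogram hrho hP hD hY) _.
have two : (0 : R) < 2 by [].
apply: lerD.
  rewrite (ler_pM2l two); apply: (retr_psdM_le hrho).
  have -> : (X - Y) *m (X - Y) - (X - Y) *m P *m (X - Y)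
            = (X - Y) *m trunc M X *m (X - Y).
    by rewrite TE; move: (X - Y) => D; rewrite mulmxBr mulmxBl mulmx1.
  exact: psd_sandwich hD hT.
rewrite -mulrA (ler_pM2l two) [M^-1 * _]mulrC ler_pdivlMr // mulrC.
rewrite -retrZ scalemxAr; apply: (retr_psdM_le hrho).
have -> : Y *m X *m Y - M%:C%C *: (Y *m P *m Y)
          = Y *m (X - M%:C%C *: P) *m Y.
  by rewrite mulmxBr mulmxBl -scalemxAr -scalemxAl.
exact: psd_sandwich hY PX.
Qed.

(** Controls the second moment of X by its first moment, the tail of the
    perturbation X + O, and the size of O.  The parameter s trades the first
    moment of O against its second moment; it is chosen after M. *)
Lemma retr_sqr_le n (rho X O : 'M[C]_n) (M s : R) : 0 < M -> 0 < s ->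
  state rho -> X \is hermsymmx -> O \is hermsymmx -> psd (X + O) ->
  retr (rho *m (X *m X)) <=
    2 * retr (rho *m ((X + O) *m (X + O)) *m (1%:M - trunc M (X + O)))
    + 2 * M * retr (rho *m X) + M * s
    + (M / s + 2) * retr (rho *m (O *m O)).
Proof.
move=> M0 s0 hrho hX hO hA; have [_ _ _ AT _] := truncP M0 hA.
set A := X + O in hA AT *; set T := trunc M A in AT *.
have first : retr (rho *m (X *m X)) <=
    2 * retr (rho *m (A *m A)) + 2 * retr (rho *m (O *m O)).
  have hNO : - O \is hermsymmx.
    by have := hermB (psd0 R n).1 hO; rewrite sub0r.
  have := retr_parallelogram hrho.1 (psd1 R n) hA.1 hNO.
  have -> : A - O = X by rewrite /A addrK.
  have -> : - O *m 1%:M *m - O = O *m O.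
    by rewrite mulmx1 mulNmx mulmxN opprK.
  by rewrite !mulmx1.
have split2 : retr (rho *m (A *m A)) = retr (rho *m (A *m A) *m (1%:M - T))
    + retr (rho *m (A *m A *m T)).
  by rewrite mulmxBr mulmx1 retrB [rho *m (A *m A *m T)]mulmxA subrK.
have bulk : retr (rho *m (A *m A *m T)) <= M * retr (rho *m A).
  by rewrite -retrZ scalemxAr; exact: retr_psdM_le hrho.1 AT.
have lin : retr (rho *m A) = retr (rho *m X) + retr (rho *m O).
  by rewrite mulmxDr retrD.
(* from Tr rho (s - O)^2 >= 0 *)
have young : 2 * retr (rho *m O) <= s + s^-1 * retr (rho *m (O *m O)).
  have sh : s%:C%C%:M - O \is hermsymmx.
    apply: hermB hO.
    rewrite hermE tr_scalar_mx map_scalar_mx /= geC0_conj //.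
    by rewrite lecR ltW.
  have := retr_psdM_ge0 hrho.1 (psd_sqr sh).
  have -> : (s%:C%C%:M - O) *m (s%:C%C%:M - O)
     = s%:C%C *: s%:C%C%:M - s%:C%C *: O - (s%:C%C *: O - O *m O).
    by rewrite mulmxBl !mulmxBr !mul_scalar_mx mul_mx_scalar.
  have -> : rho *m (s%:C%C *: s%:C%C%:M - s%:C%C *: O - (s%:C%C *: O - O *m O))
     = s%:C%C *: (s%:C%C *: rho) - s%:C%C *: (rho *m O)
       - (s%:C%C *: (rho *m O) - rho *m (O *m O)).
    by rewrite 3!mulmxBr -2!scalemxAr mul_mx_scalar.
  rewrite 3!retrB 3!retrZ.
  have -> : retr rho = 1 by rewrite /retr hrho.2.
  rewrite mulr1; exact: young_from_square.
have M2 := ler_wpM2l (ltW M0) young.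
exact: collect_bounds first split2 bulk lin M2.
Qed.

End Estimates.

(** * Tensor products *)

Section Tensors.
Local Open Scope sesquilinear_scope.
Variable R : realType.
Local Notation C := R[i].

Lemma mxtrace_tensmx m n (A : 'M[C]_m) (B : 'M[C]_n) :
  \tr (mxtens.tensmx A B) = \tr A * \tr B.
Proof.
by rewrite /mxtrace mxtens.mulr_sum; apply: eq_bigr => k _; rewrite mxE.
Qed.

Lemma psd_tensmx m n (A : 'M[C]_m) (B : 'M[C]_n) :
  psd A -> psd B -> psd (mxtens.tensmx A B).
Proof.
move=> /psd_gram[K ->] /psd_gram[J ->].
rewrite -mxtens.tensmx_mul -mxtens.map_mxT -mxtens.trmx_tens.
exact: gram_psd.
Qed.

Variable d : nat -> nat.
Implicit Types A B : forall i, 'M[C]_(d i).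

Lemma tens_mul A B n :
  tens A n *m tens B n = tens (fun i => A i *m B i) n.
Proof.
elim: n => [|n IH] /=; first by rewrite mulmx1.
by rewrite mxtens.tensmx_mul IH.
Qed.

Lemma mxtrace_tens A n : \tr (tens A n) = \prod_(0 <= i < n) \tr (A i).
Proof.
elim: n => [|n IH] /=; first by rewrite big_nil mxtrace1.
by rewrite mxtrace_tensmx IH big_nat_recr.
Qed.

Lemma psd_tens A n : (forall i, psd (A i)) -> psd (tens A n).
Proof.
by move=> hA; elim: n => [|n IH] /=; [exact: psd1 | exact: psd_tensmx].
Qed.

Lemma retr_tens A (a : nat -> R) n : (forall i, \tr (A i) = (a i)%:C%C) ->
  retr (tens A n) = \prod_(0 <= i < n) a i.
Proof.
move=> trA; rewrite /retr mxtrace_tens (eq_bigr _ (fun i _ => trA i)).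
by rewrite -(rmorph_prod (real_complex R)).
Qed.

End Tensors.

(** * Infinite products of numbers in (0, 1] *)

Lemma prod_bounded (R : realFieldType) (c : nat -> R) (m : nat) :
  (forall i, 0 <= c i) -> (forall i, (m <= i)%N -> c i <= 1) ->
  forall n, \prod_(0 <= i < n) c i <= \prod_(0 <= i < m) (1 + c i).
Proof.
move=> c0 c1 n.
have c1_ge k : 1 <= \prod_(k <= i < m) (1 + c i).
  apply: (big_ind (fun x => 1 <= x)) => // [x y|i _]; first exact: mulr_ege1.
  by rewrite lerDl.
have le_c k : \prod_(0 <= i < k) c i <= \prod_(0 <= i < k) (1 + c i).
  by apply: ler_prod => i _; rewrite c0 lerDr ler01.
have p0 k k' : 0 <= \prod_(k <= i < k') c i by apply: prodr_ge0 => i _.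
have [nm|/ltnW mn] := leqP n m.
  rewrite (big_cat_nat (leq0n n) nm) /= -[leLHS]mulr1.
  by apply: ler_pM => //; exact: ler01.
rewrite (big_cat_nat (leq0n m) mn) /= -[leRHS]mulr1.
apply: ler_pM => //; rewrite big_nat_cond.
apply: prodr_ile1 => i /andP[/andP[mi _] _].
by rewrite c0 c1.
Qed.

Section InfiniteProducts.
Variables (R : realType) (a : nat -> R).
Hypothesis a01 : forall i, 0 < a i <= 1.

Local Notation p n := (\prod_(0 <= i < n) a i).

Let a_ge0 i : 0 <= a i. Proof. by case/andP: (a01 i) => /ltW. Qed.
Let a_le1 i : a i <= 1. Proof. by case/andP: (a01 i). Qed.

Lemma prod_gt0 m n : 0 < \prod_(m <= i < n) a i.
Proof. by apply: prodr_gt0 => i _; case/andP: (a01 i). Qed.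

Lemma prod_le1 m n : \prod_(m <= i < n) a i <= 1.
Proof. by apply: prodr_ile1 => i _; rewrite a_ge0 a_le1. Qed.

Lemma prod_nonincreasing : nonincreasing_seq (fun n => p n).
Proof.
move=> m n mn; rewrite (big_cat_nat (leq0n m) mn) /=.
by rewrite ler_piMr ?prod_le1 // ltW // prod_gt0.
Qed.

Lemma prod_is_cvg : cvgn (fun n => p n).
Proof.
apply: nonincreasing_is_cvgn prod_nonincreasing _.
by exists 0 => _ [n _ <-]; rewrite ltW // prod_gt0.
Qed.

Lemma prod_ge_lim l n : (fun n => p n) @ \oo --> l -> l <= p n.
Proof.
move=> pl; rewrite -(cvg_lim (@Rhausdorff R) pl).
exact: nonincreasing_cvgn_ge prod_nonincreasing prod_is_cvg n.
Qed.

Lemma prod_cvg_of_lbound c : 0 < c -> (\forall n \near \oo, c <= p n) ->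
  exists2 l : R, 0 < l & (fun n => p n) @ \oo --> l.
Proof.
move=> c0 cp; exists (limn (fun n => p n)); last exact: prod_is_cvg.
exact: lt_le_trans c0 (limr_ge prod_is_cvg cp).
Qed.

(** An elementary substitute for p_n <= exp (- sum (1 - a_i)): a positive lower
    bound on p_n bounds the partial sums. *)
Lemma prod_mul_sum_le1 n : p n * (1 + \sum_(0 <= i < n) (1 - a i)) <= 1.
Proof.
elim: n => [|n IH]; first by rewrite !big_nil addr0 mulr1.
have hp := prod_le1 0 n; have hp0 := ltW (prod_gt0 0 n).
rewrite !big_nat_recr //=; have := a_ge0 n; have := a_le1 n.
move: (\prod_(_ <= _ < _) _) (\sum_(_ <= _ < _) _) (a n) hp hp0 IH => x s y.
move=> x1 x0 xs y1 y0; have h1 := ler_wpM2l y0 xs.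
have h2 : x * y * (1 - y) <= 1 * (1 - y).
  by rewrite ler_wpM2r ?subr_ge0 // mulr_ile1.
lra.
Qed.

(** Applied from an index beyond which the sum is less than 1/2, this keeps the
    product away from 0. *)
Lemma prod_ge_sum m n :
  1 - \sum_(m <= i < n) (1 - a i) <= \prod_(m <= i < n) a i.
Proof.
have [nm|/ltnW mn] := leqP n m; first by rewrite !big_geq // subr0.
rewrite -(subnKC mn); elim: (n - m)%N => [|k IH].
  by rewrite addn0 !big_geq // subr0.
have hp := prod_le1 m (m + k); have hp0 := ltW (prod_gt0 m (m + k)).
rewrite addnS !big_nat_recr ?leq_addr //=.
have := a_ge0 (m + k); have := a_le1 (m + k).
move: (\prod_(_ <= _ < _) _) (\sum_(_ <= _ < _) _) (a _) hp hp0 IH => x s y.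
move=> x1 x0 xs y1 y0.
have h2 : x * (1 - y) <= 1 * (1 - y) by rewrite ler_wpM2r ?subr_ge0.
lra.
Qed.

Lemma prod_pos_iff_summable :
  (exists2 l : R, 0 < l & (fun n => p n) @ \oo --> l) <->
  (\sum_(0 <= i <oo) (1 - a i)%:E < +oo)%E.
Proof.
have t0 i : (0 <= (1 - a i)%:E)%E by rewrite lee_fin subr_ge0.
split=> [[l l0 pl]|sfin].
  apply: (@le_lt_trans _ _ (l^-1)%:E); last exact: ltry.
  apply: lime_le; first by apply: is_cvg_nneseries => i _ _; exact: t0.
  apply: nearW => n; rewrite sumEFin lee_fin.
  have := prod_mul_sum_le1 n; have := prod_ge_lim n pl.
  have s0 : 0 <= \sum_(0 <= i < n) (1 - a i).
    by apply: sumr_ge0 => i _; rewrite subr_ge0.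
  rewrite -[l^-1]mulr1 ler_pdivlMl //.
  move: (\prod_(_ <= _ < _) _) (\sum_(_ <= _ < _) _) s0 => x s s0 lx xs.
  have h : l * (1 + s) <= x * (1 + s) by rewrite ler_wpM2r // addr_ge0.
  lra.
have /fine_cvgP[tfin /cvgr_lt/(_ 2^-1)] :=
  nneseries_tail_cvg sfin (fun i _ => t0 i).
rewrite invr_gt0 ltr0n => /(_ isT) tlt.
have [m [mfin mlt]] : exists m,
    (\sum_(m <= i <oo) (1 - a i)%:E)%E \is a fin_num /\
    fine (\sum_(m <= i <oo) (1 - a i)%:E)%E < 2^-1.
  have [m _ hm] := filterI tfin tlt.
  by exists m; apply: (hm m) => /=.
apply: (@prod_cvg_of_lbound (p m / 2)); first by rewrite divr_gt0 ?prod_gt0.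
exists m => // n /= mn; rewrite (big_cat_nat (leq0n m) mn) /=.
rewrite ler_pM2l ?prod_gt0 //; apply: le_trans (prod_ge_sum m n).
have : \sum_(m <= i < n) (1 - a i) <= fine (\sum_(m <= i <oo) (1 - a i)%:E)%E.
  rewrite -lee_fin fineK // -sumEFin.
  by apply: nneseries_lim_ge => i _ _; exact: t0.
lra.
Qed.

End InfiniteProducts.

(** * Contiguity of product states *)

Section Kakutani.
Variables (R : realType) (d : nat -> nat).
Variables (rho sigma L : forall i : nat, 'M[R[i]]_(d i)).
Hypothesis rho_state : forall i, state (rho i).
Hypothesis sigma_state : forall i, state (sigma i).
Hypothesis sigma_ac_rho : forall i, abs_cont (sigma i) (rho i).
Hypothesis L_version : forall i, sqrt_lr_version (sigma i) (rho i) (L i).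

Let a i := retr (rho i *m L i).
Local Notation p n := (\prod_(0 <= i < n) a i).

Let hrho i : psd (rho i) := (rho_state i).1.
Let hsigma i : psd (sigma i) := (sigma_state i).1.
Let hL i : psd (L i) := (L_version i).1.

Let a01 i : 0 < a i <= 1.
Proof.
exact: (retr_version_bounds (rho_state i) (sigma_state i)
                            (sigma_ac_rho i) (L_version i)).
Qed.

Let mxtrace_a i : \tr (rho i *m L i) = (a i)%:C%C.
Proof. exact: mxtrace_psdM (hrho i) (hL i). Qed.

Let mxtrace_LL i : \tr (rho i *m (L i *m L i)) = (1 : R)%:C%C.
Proof.
exact: (mxtrace_version_sqr (rho_state i) (sigma_state i)
                            (sigma_ac_rho i) (L_version i)).
Qed.

Let mxtrace_rho i : \tr (rho i) = (1 : R)%:C%C.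
Proof. exact: (rho_state i).2. Qed.

Lemma tens_state n : state (tens rho n).
Proof.
split; first exact: psd_tens.
by rewrite mxtrace_tens big1 // => i _; exact: (rho_state i).2.
Qed.

Lemma tens_version n : sqrt_lr_version (tens sigma n) (tens rho n) (tens L n).
Proof.
split; first exact: psd_tens.
exists 0; split; [exact: psd0 | exact: singular0 |].
rewrite addr0 !tens_mul; congr (tens _ n).
apply: functional_extensionality_dep => i.
exact: version_eq (hrho i) (hsigma i) (sigma_ac_rho i) (L_version i).
Qed.

Lemma retr_tens_L n : retr (tens rho n *m tens L n) = p n.
Proof. by rewrite tens_mul; exact: retr_tens. Qed.

Lemma retr_tens_LL n : retr (tens rho n *m (tens L n *m tens L n)) = 1.
Proof. by rewrite !tens_mul (retr_tens n mxtrace_LL) big1. Qed.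

Section Head.
Variable m : nat.

(** The factors of the operator Y of the first direction: the likelihood ratio
    of the first m factors, extended by 1.  It is written as a product family so
    that its moments are products of numbers, for n < m as well as n >= m. *)
Definition headL i : 'M[R[i]]_(d i) := if (i < m)%N then L i else 1%:M.

(* Tr rho_i Y_i L_i Y_i *)
Let b i := if (i < m)%N then retr (rho i *m (L i *m L i *m L i)) else a i.

Lemma psd_headL i : psd (headL i).
Proof. by rewrite /headL; case: ifP => _; [exact: hL | exact: psd1]. Qed.

Lemma head_dist n :
  retr (tens rho n *m ((tens L n - tens headL n) *m (tens L n - tens headL n)))
  = 2 * (1 - \prod_(0 <= i < n) (if (i < m)%N then 1 else a i)).
Proof.
rewrite retr_sqrB retr_tens_LL.
have XY : retr (tens rho n *m (tens L n *m tens headL n))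
    = \prod_(0 <= i < n) (if (i < m)%N then 1 else a i).
  rewrite !tens_mul; apply: retr_tens => i; rewrite /headL.
  by case: ifP => _; [exact: mxtrace_LL | rewrite mulmx1].
have YX : retr (tens rho n *m (tens headL n *m tens L n))
    = \prod_(0 <= i < n) (if (i < m)%N then 1 else a i).
  rewrite !tens_mul; apply: retr_tens => i; rewrite /headL.
  by case: ifP => _; [exact: mxtrace_LL | rewrite mul1mx].
have YY : retr (tens rho n *m (tens headL n *m tens headL n)) = 1.
  rewrite !tens_mul (@retr_tens _ _ _ (fun=> 1)) ?big1 // => i; rewrite /headL.
  by case: ifP => _; [exact: mxtrace_LL | rewrite !mulmx1 mxtrace_rho].
rewrite XY YX YY.
by move: (\prod_(_ <= _ < _) _) => x; ring.
Qed.

(** Only the first m factors of Y X Y can exceed 1 in expectation, so the bound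
    does not depend on n; this is what allows a single truncation level M. *)
Lemma head_bounded : exists K : R, forall n,
  retr (tens rho n *m (tens headL n *m tens L n *m tens headL n)) <= K.
Proof.
exists (\prod_(0 <= i < m) (1 + b i)) => n.
rewrite !tens_mul (@retr_tens _ _ _ b).
  apply: prod_bounded => i; rewrite /b.
    case: ifP => _; last by case/andP: (a01 i) => /ltW.
    by apply: retr_psdM_ge0 => //; exact: psd_sandwich (hL i).1 (hL i).
  by rewrite ltnNge => ->; case/andP: (a01 i).
move=> i; rewrite /headL /b; case: ifP => _; last first.
  by rewrite mul1mx mulmx1 mxtrace_a.
by apply: mxtrace_psdM => //; exact: psd_sandwich (hL i).1 (hL i).
Qed.

End Head.

Lemma tens_unif_integrable (l : R) : 0 < l -> (fun n => p n) @ \oo --> l ->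
  sq_unif_integrable (fun n => tens rho n.+1) (fun n => tens L n.+1).
Proof.
move=> l0 pl e e0.
have [m pm] : exists m, p m < l + l * (e / 16).
  have /cvgr_lt/(_ (l + l * (e / 16))) := pl.
  rewrite ltrDl mulr_gt0 ?divr_gt0 // => /(_ isT)[m _ hm].
  by exists m; apply: (hm m) => /=.
(* for n >= m the product is p n / p m, where l <= p n and p m < l (1 + e/16);
   for n < m it is 1 *)
have headq n : 1 - e / 16 <= \prod_(0 <= i < n) (if (i < m)%N then 1 else a i).
  have pm0 := prod_gt0 a01 0 m.
  have lpm := prod_ge_lim a01 m pl.
  have lq : l <= p m * \prod_(0 <= i < n) (if (i < m)%N then 1 else a i).
    have [nm|/ltnW mn] := leqP n m.
      have -> : \prod_(0 <= i < n) (if (i < m)%N then 1 else a i) = 1.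
        rewrite big_nat_cond big1 // => i /andP[/andP[_ iN] _].
        by rewrite (leq_trans iN nm).
      by rewrite mulr1.
    rewrite (big_cat_nat (leq0n m) mn) /=.
    have -> : \prod_(0 <= i < m) (if (i < m)%N then 1 else a i) = 1.
      by rewrite big_nat_cond big1 // => i /andP[/andP[_ ->]].
    have -> : \prod_(m <= i < n) (if (i < m)%N then 1 else a i)
        = \prod_(m <= i < n) a i.
      by apply: eq_big_nat => i /andP[mi _]; rewrite ltnNge mi.
    by rewrite mul1r -big_cat_nat //; exact: prod_ge_lim.
  rewrite -(ler_pM2l pm0); apply: le_trans lq.
  have h : l * (e / 16) <= p m * (e / 16) by rewrite ler_wpM2r ?divr_ge0 // ltW.
  by rewrite mulrBr mulr1; move: (p m) pm h => x; lra.
have [K0 hK0] := head_bounded m.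
have [K [Kpos hK]] : exists K, 0 < K /\ forall n,
  retr (tens rho n *m (tens (headL m) n *m tens L n *m tens (headL m) n)) <= K.
  exists (Num.max K0 1); split=> [|n]; first by rewrite lt_max ltr01 orbT.
  by rewrite le_max hK0.
(* M = 8 K / e makes 2 K / M equal to e / 4; with the distance term, which is
   at most 4 (e / 16), the tail is at most e / 2 *)
have M0 : 0 < 8 * K / e by rewrite divr_gt0 ?mulr_gt0.
exists (8 * K / e) => //.
apply: (@le_lt_trans _ _ (e / 2)%:E); last by rewrite lte_fin; lra.
apply: ge_ereal_sup => _ [n _ <-]; rewrite lee_fin.
apply: le_trans (retr_tail_le M0 (psd_tens n.+1 hrho) (psd_tens n.+1 hL)
  (psd_tens n.+1 (psd_headL m)).1) _.
rewrite head_dist.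
have h1 := headq n.+1.
have h2 : 2 / (8 * K / e) * retr (tens rho n.+1 *m
    (tens (headL m) n.+1 *m tens L n.+1 *m tens (headL m) n.+1)) <= e / 4.
  apply: (@le_trans _ _ (2 / (8 * K / e) * K)).
    by rewrite ler_wpM2l ?hK // divr_ge0 // ltW.
  by rewrite le_eqVlt; apply/orP; left; apply/eqP; field; rewrite !gt_eqF.
move: (retr _) h1 h2 => x.
move: (\prod_(_ <= _ < _) _) (8 * K / e) => y z h1 h2; lra.
Qed.

Lemma contiguous_of_prod_pos (l : R) : 0 < l -> (fun n => p n) @ \oo --> l ->
  contiguous (fun n => tens sigma n.+1) (fun n => tens rho n.+1).
Proof.
move=> l0 pl; exists (fun n => tens L n.+1); split=> [n | | ].
- exact: tens_version.
- under eq_fun do rewrite retr_tens_LL.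
  exact: cvg_cst.
- exists (fun=> 0); split=> [n | | n | ].
  + exact: (psd0 _ _).1.
  + rewrite /L2_infinitesimal; under eq_fun do rewrite mul0mx mulmx0.
    have -> : (fun n => retr (0 : 'M[R[i]]_(tens_dim d n.+1))) = (fun=> 0).
      by apply: funext => n; rewrite /retr mxtrace0.
    exact: cvg_cst.
  + by rewrite addr0; exact: psd_tens.
  + have -> : (fun n => tens L n.+1 + 0) = (fun n => tens L n.+1).
      by apply: functional_extensionality_dep => n; rewrite addr0.
    exact: tens_unif_integrable pl.
Qed.

Lemma prod_pos_of_contiguous :
  contiguous (fun n => tens sigma n.+1) (fun n => tens rho n.+1) ->
  exists2 l : R, 0 < l & (fun n => p n) @ \oo --> l.
Proof.
move=> [X [hX X2 [Z [hZ Z2 XZ ui]]]].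
have [//|no_pos_lim] :=
  pselect (exists2 l : R, 0 < l & (fun n => p n) @ \oo --> l).
exfalso.
(* being nonincreasing and positive, p n converges, and only to 0 *)
have p0 : (fun n => p n) @ \oo --> 0.
  have pc := prod_is_cvg a01.
  suff <- : limn (fun n => p n) = 0 by [].
  apply/eqP; rewrite eq_le; apply/andP; split.
    rewrite leNgt; apply/negP => l0; apply: no_pos_lim.
    by exists (limn (fun n => p n)).
  apply: limr_ge => //; apply: nearW => n; exact/ltW/prod_gt0.
have [M M0 uiM] := ui 8^-1 (ltac:(by rewrite invr_gt0)).
have tail n : retr (tens rho n.+1 *m ((X n + Z n) *m (X n + Z n))
    *m (1%:M - trunc M (X n + Z n))) <= 8^-1.
  rewrite -lee_fin; apply: le_trans (ltW uiM).
  by apply: ereal_sup_ubound; exists n.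
(* s = 1 / (8 M) makes the term M s of the estimate equal to 1 / 8 *)
have s0 : 0 < (8 * M)^-1 by rewrite invr_gt0 mulr_gt0.
have bound n : retr (tens rho n.+1 *m (X n *m X n)) <=
   3 / 8 + 2 * M * p n.+1
   + (M / (8 * M)^-1 + 2) * retr (tens rho n.+1 *m (Z n *m Z n)).
  have := retr_sqr_le M0 s0 (tens_state n.+1) (hX n).1.1 (hZ n) (XZ n).
  rewrite (version_retr_unique (psd_tens n.+1 hrho) (hX n) (tens_version n.+1)).
  rewrite retr_tens_L; have := tail n.
  have -> : M * (8 * M)^-1 = 8^-1 by field; rewrite gt_eqF.
  move: (retr _) (retr _) (retr _) (p n.+1) => x y z q.
  by move: (M / _ + 2) => w; lra.
have : 1 <= 3 / 8 + 2 * M * 0 + (M / (8 * M)^-1 + 2) * 0 :> R.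
  have rhs : (fun n => 3 / 8 + 2 * M * p n.+1 + (M / (8 * M)^-1 + 2)
       * retr (tens rho n.+1 *m (Z n *m Z n))) @ \oo -->
      3 / 8 + 2 * M * 0 + (M / (8 * M)^-1 + 2) * 0.
    apply: cvgD; last by apply: cvgM; [exact: cvg_cst | exact: Z2].
    apply: cvgD; first exact: cvg_cst.
    apply: cvgM; first exact: cvg_cst.
    by rewrite (cvg_shiftS (fun n => p n)).
  by apply: (ler_cvg_to X2 rhs); exact: nearW.
by rewrite !mulr0 !addr0; lra.
Qed.

End Kakutani.

Theorem theorem7p2 (R : realType) (d : nat -> nat)
    (rho sigma : forall i : nat, 'M[R[i]]_(d i))
    (rho_state : forall i, state (rho i))
    (sigma_state : forall i, state (sigma i))
    (sigma_ac_rho : forall i, abs_cont (sigma i) (rho i))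
    (L : forall i : nat, 'M[R[i]]_(d i))
    (L_version : forall i, sqrt_lr_version (sigma i) (rho i) (L i)) :
  (contiguous (fun n => tens sigma n.+1) (fun n => tens rho n.+1) <->
   exists2 l : R, 0 < l &
     (fun n => \prod_(0 <= i < n) retr (rho i *m L i)) @ \oo --> l)
  /\
  ((exists2 l : R, 0 < l &
     (fun n => \prod_(0 <= i < n) retr (rho i *m L i)) @ \oo --> l) <->
   (\sum_(0 <= i <oo) (1 - retr (rho i *m L i))%:E < +oo)%E).
Proof.
have a01 i : 0 < retr (rho i *m L i) <= 1.
  exact: (retr_version_bounds (rho_state i) (sigma_state i)
                              (sigma_ac_rho i) (L_version i)).
split; last exact: prod_pos_iff_summable.
split=> [cont|[l l0 pl]].
  exact: (prod_pos_of_contiguous rho_state sigma_state sigma_ac_rho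
                                 L_version cont).
exact: (contiguous_of_prod_pos rho_state sigma_state sigma_ac_rho
                               L_version l0 pl).
Qed.
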